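(* Let $G=\langle\sigma,\tau\rangle$ be the Klein four-group, let $\Bbbk$ be a field of characteristic $2$, and let $\chi=\{H_1,H_2,H_3\}$ with $H_1=\langle\sigma\rangle$, $H_2=\langle\tau\rangle$, $H_3=\langle\sigma\tau\rangle$. Let $N\in\{P,Q_\sigma,Q_\tau,Q_{\sigma\tau}\}$, where $P=\Bbbk G$ is the projective indecomposable module and $Q_\sigma=\Bbbk_{H_1}\uparrow^G$, $Q_\tau=\Bbbk_{H_2}\uparrow^G$, $Q_{\sigma\tau}=\Bbbk_{H_3}\uparrow^G$. Then for every integer $i\ge 0$, $$\dim H^i_\chi(G,N)=\begin{cases}1 & i=0,\\ 0&\text{otherwise.}\end{cases}$$
   Context: All modules are finitely generated. $\Bbbk_H\uparrow^G$ denotes the module induced to $G$ from the trivial $\Bbbk H$-module. A $\Bbbk G$-module $M$ is projective relative to $\chi$ if it is a direct summand of $\bigoplus_{H\in\chi} M\downarrow_H\uparrow^G$. Relative cohomology $H^i_\chi(G,N)=\mathrm{Ext}^i_{\Bbbk G,\chi}(\Bbbk,N)$ is the $i$-th homology of the complex $0\to\mathrm{Hom}_{\Bbbk G}(Q_0,N)\to\mathrm{Hom}_{\Bbbk G}(Q_1,N)\to\cdots$, where $\cdots\to Q_1\to Q_0\to\Bbbk\to 0$ is a relative projective resolution of the trivial module: an exact complex in which each $Q_i$ is projective relative to $\chi$ and the connecting homomorphisms split over each $H\in\chi$ (i.e. the complex is split exact on restriction to each $H\in\chi$). It is independent of the choice of resolution. *)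

(* Defs.v *)
(* MathComp.  A finite group is a finGroupType [gT]; a finitely generated
   k[gT]-module is a matrix representation [representation k [set: gT]]. *)
From HB Require Import structures.
From mathcomp Require Import all_boot all_order all_algebra.
From mathcomp Require Import all_fingroup all_solvable all_field all_character.

Set Implicit Arguments.
Unset Strict Implicit.
Unset Printing Implicit Defensive.

Import GroupScope GRing.Theory.
Local Open Scope ring_scope.

Section Modules.

Variables (k : fieldType) (gT : finGroupType).
Implicit Types (H : {group gT}) (chi : {set {group gT}}).

Lemma triv_mx_repr (G : {group gT}) : mx_repr G (fun=> 1%:M : 'M[k]_1).
Proof. by split=> // x y _ _; rewrite mulmx1. Qed.

Definition triv_grepr (G : {group gT}) : representation k G :=
  Representation (MxRepresentation (triv_mx_repr G)).

Definition regular_grepr (G : {group gT}) : representation k G :=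
  Representation (regular_repr k G).

Definition res_grepr H (M : representation k [set: gT]) : representation k H :=
  Representation (subg_repr M (subsetT H)).

(* Induction M (x)_{kH} kG, for modules acting on the right of row vectors.
   If t_i is the chosen representative of the i-th right coset of H, then
   (e (x) t_i) x = (e h) (x) t_j where t_i x = h t_j with h in H, so that the
   (i, j) block of the action of x is that of h = t_i x t_j^-1, or 0 if this
   element is not in H. *)
Definition coset_rep H (i : 'I_#|rcosets H [set: gT]|) : gT :=
  repr (enum_val i).

Definition ind_mx H (M : representation k H) (x : gT) :=
  \mxblock_(i < #|rcosets H [set: gT]|, j < #|rcosets H [set: gT]|)
     (let h := (coset_rep i * x * (coset_rep j)^-1)%g in
      if h \in H then M h else 0 : 'M[k]_(rdegree M)).

Lemma rcoset_coset_rep H (i : 'I_#|rcosets H [set: gT]|) :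
  H :* coset_rep i = enum_val i.
Proof.
by rewrite /coset_rep; case/rcosetsP: (enum_valP i) => x _ ->; rewrite rcoset_repr.
Qed.

Lemma coset_rep_inj H (i j : 'I_#|rcosets H [set: gT]|) :
  (coset_rep i * (coset_rep j)^-1)%g \in H -> i = j.
Proof.
by rewrite -mem_rcoset => /rcoset_eqP; rewrite !rcoset_coset_rep => /enum_val_inj.
Qed.

Lemma coset_rep_ex H (x : gT) :
  {j : 'I_#|rcosets H [set: gT]| | (x * (coset_rep j)^-1)%g \in H}.
Proof.
have Hx : H :* x \in rcosets H [set: gT] by rewrite mem_rcosets mulSGid ?subsetT ?inE.
exists (enum_rank_in Hx (H :* x)).
by rewrite -mem_rcoset rcoset_coset_rep enum_rankK_in // rcoset_refl.
Qed.

Lemma ind_mx_repr H (M : representation k H) : mx_repr [set: gT] (ind_mx M).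
Proof.
split=> [|x y _ _].
  rewrite /ind_mx -[RHS]mxdiagZ /mxdiag; apply: eq_mxblock => i j /=.
  rewrite mulg1; case: (altP (i =P j)) => [<-|neq_ij].
    by rewrite mulgV group1 repr_mx1 conform_mx_id.
  by case: ifP => // /coset_rep_inj eq_ij; rewrite eq_ij eqxx in neq_ij.
rewrite /ind_mx mul_mxblock; apply: eq_mxblock => i l /=.
have [j Hj] := coset_rep_ex H (coset_rep i * x)%g.
rewrite (bigD1 j) //= Hj [X in _ + X]big1 ?addr0 => [|j' neq_j].
  have ->: (coset_rep i * (x * y) * (coset_rep l)^-1)%g
      = ((coset_rep i * x * (coset_rep j)^-1)
        * (coset_rep j * y * (coset_rep l)^-1))%g.
    by rewrite !mulgA mulgKV.
  rewrite groupMl //; case: ifP => Hl; last by rewrite mulmx0.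
  by rewrite repr_mxM.
case: ifP => Hj'; last by rewrite mul0mx.
case/eqP: neq_j; apply: coset_rep_inj.
by rewrite -(groupMl _ Hj') mulgA mulgKV.
Qed.

Definition ind_grepr H (M : representation k H) : representation k [set: gT] :=
  Representation (MxRepresentation (ind_mx_repr M)).

Definition rel_projective chi (M : representation k [set: gT]) : Prop :=
  exists L : representation k [set: gT],
    mx_rsim (\big[@dadd_grepr k gT _/grepr0]_(H in chi) ind_grepr (res_grepr H M))
            (dadd_grepr M L).

(* Maps act on the right of row vectors: [f] is the map v |-> v *m f, and
   [f *m g] is "f, then g". *)
Definition module_hom (G : {group gT}) (M N : representation k G)
    (f : 'M[k]_(rdegree M, rdegree N)) : Prop :=
  forall x, x \in G -> M x *m f = f *m N x.

(* f splits over H: im f and ker f are kH-summands, i.e. f s f = f for some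
   kH-map s.  For an exact complex this is split exactness on restriction. *)
Definition splits_over H (M N : representation k [set: gT])
    (f : 'M[k]_(rdegree M, rdegree N)) : Prop :=
  exists2 s : 'M[k]_(rdegree N, rdegree M),
    @module_hom H (res_grepr H N) (res_grepr H M) s & f *m s *m f = f.

Record rel_resolution chi (M : representation k [set: gT]) := RelResolution {
  rr_mod : nat -> representation k [set: gT];
  rr_diff : forall i, 'M[k]_(rdegree (rr_mod i.+1), rdegree (rr_mod i));
  rr_aug : 'M[k]_(rdegree (rr_mod 0), rdegree M);
  rr_proj : forall i, rel_projective chi (rr_mod i);
  rr_diff_hom : forall i, module_hom (rr_diff i);
  rr_aug_hom : module_hom rr_aug;
  rr_exact : forall i, (rr_diff i.+1 :=: kermx (rr_diff i))%MS;
  rr_exact0 : (rr_diff 0 :=: kermx rr_aug)%MS;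
  rr_aug_surj : row_full rr_aug;
  rr_diff_split : forall H i, H \in chi -> splits_over H (rr_diff i);
  rr_aug_split : forall H, H \in chi -> splits_over H rr_aug
}.

Definition hom_vspace (M N : representation k [set: gT]) :
    {vspace 'M[k]_(rdegree M, rdegree N)} :=
  (\bigcap_(x : gT) lker (linfun (mulmx (M x)) - linfun (mulmxr (N x))))%VS.

Lemma hom_vspaceP (M N : representation k [set: gT])
    (f : 'M[k]_(rdegree M, rdegree N)) :
  reflect (module_hom f) (f \in hom_vspace M N).
Proof.
rewrite /hom_vspace memvE; apply: (iffP subv_bigcapP) => [homf x _ | homf x _].
  move: (homf x isT); rewrite -memvE memv_ker add_lfunE opp_lfunE !lfunE /=.
  by rewrite subr_eq0 => /eqP.
by rewrite -memvE memv_ker add_lfunE opp_lfunE !lfunE /= subr_eq0 homf ?inE.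
Qed.

Section Ext.

Variables (chi : {set {group gT}}) (M N : representation k [set: gT]).
Variable Q : rel_resolution chi M.

Definition cochain_diff i :
    'Hom('M[k]_(rdegree (rr_mod Q i), rdegree N),
         'M[k]_(rdegree (rr_mod Q i.+1), rdegree N)) :=
  linfun (mulmx (rr_diff Q i)).

Definition cocycles i := (hom_vspace (rr_mod Q i) N :&: lker (cochain_diff i))%VS.

Definition coboundaries i : {vspace 'M[k]_(rdegree (rr_mod Q i), rdegree N)} :=
  match i with
  | 0 => 0%VS
  | j.+1 => (cochain_diff j @: hom_vspace (rr_mod Q j) N)%VS
  end.

Lemma coboundaries_sub i : (coboundaries i <= cocycles i)%VS.
Proof.
case: i => [|i] /=; first exact: sub0v.
apply/subvP=> _ /memv_imgP[f /hom_vspaceP homf ->]; rewrite memv_cap memv_ker.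
rewrite !lfunE /= mulmxA; apply/andP; split.
  by apply/hom_vspaceP=> x Gx; rewrite mulmxA rr_diff_hom // -!mulmxA homf.
suff ->: rr_diff Q i.+1 *m rr_diff Q i = 0 by rewrite mul0mx.
by apply/sub_kermxP; rewrite (rr_exact Q i).
Qed.

Definition rel_Ext_dim i : nat := (\dim (cocycles i) - \dim (coboundaries i))%N.

End Ext.

(* dim H^i_chi(G, N) = d.  The existence clause ensures that the invariance
   clause (all resolutions give the same dimension d) is not vacuous. *)
Definition rel_cohomology_dim chi (N : representation k [set: gT]) (i d : nat) :=
  inhabited (rel_resolution chi (triv_grepr [set: gT])) /\
  forall Q : rel_resolution chi (triv_grepr [set: gT]), rel_Ext_dim N Q i = d.

End Modules.

Arguments triv_grepr k {gT} G.
Arguments regular_grepr k {gT} G.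

(* Main.v *)
Require Import Defs.
From mathcomp Require Import all_boot all_order all_algebra.
From mathcomp Require Import all_fingroup all_solvable all_field all_character.

(** Each of the four coefficient modules is induced from the trivial module of
    a subgroup [H] of a member of [chi]: [kG] from the trivial subgroup, the
    others from a member of [chi] itself.  For such an [N], Frobenius
    reciprocity turns Hom_G(Q_*, N) into Hom_H(Q_*, k); since the augmented
    resolution Q_* -> k is split exact over [H], the result is exact except for
    Hom_H(k, k), a line in degree 0.

    Frobenius reciprocity is used through the relative trace
    Tr_H f = sum_A t_A^-1 f t_A over the right cosets A of [H], which makes a
    [G]-map of an [H]-map and is compatible with composition by [G]-maps.  A
    module induced from [H] has an [H]-endomorphism p with Tr_H p = 1
    ([ind_trace]).  So a [G]-map f : A -> N that vanishes on the kernel of a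
    map d : A -> B split over [H] by s extends to B: over [H], f = d (s f), and
    Tr_H (s f p) is a [G]-map with d Tr_H (s f p) = Tr_H (f p) = f
    ([extend_along_split]).  Applied to the differentials this kills the
    cohomology in positive degrees; applied to the augmentation it identifies
    H^0 with Hom_G(k, N), a line ([triv_hom_line]).

    Relative projective resolutions exist for every nonempty [chi]
    ([rel_resolution_exists]).  Cover [M] by the direct sum of the
    ind_H (res_H M), H in chi; the counit splits over every member of [chi], and
    one iterates on its kernel.  The cover is relatively projective because an
    induced module satisfies Higman's criterion, which is stable under direct
    sums ([trace_projective]) and implies relative projectivity
    ([trace_projective_rel]). *)

Set Implicit Arguments.
Unset Strict Implicit.
Unset Printing Implicit Defensive.

Import GroupScope GRing.Theory.
Local Open Scope ring_scope.

(** * Homomorphisms and relative traces *)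

Section RelativeCohomology.

Variables (k : fieldType) (gT : finGroupType).
Local Notation hom_over H X Y f := (@module_hom k gT H%G X Y f).
Local Notation hom_res H X Y f :=
  (@module_hom k gT H%G (res_grepr H%G X) (res_grepr H%G Y) f).
Implicit Types (H : {group gT}) (M N W X Y Z : representation k [set: gT]).

Lemma module_homM (G : {group gT}) (X Y Z : representation k G) f g :
  hom_over G X Y f -> hom_over G Y Z g -> hom_over G X Z (f *m g).
Proof. by move=> homf homg x Gx; rewrite mulmxA homf // -!mulmxA homg. Qed.

Lemma module_hom1 (G : {group gT}) (X : representation k G) :
  hom_over G X X 1%:M.
Proof. by move=> x _; rewrite mulmx1 mul1mx. Qed.

Lemma module_hom0 (G : {group gT}) (X Y : representation k G) :
  hom_over G X Y 0.
Proof. by move=> x _; rewrite mulmx0 mul0mx. Qed.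

Lemma module_homB (G : {group gT}) (X Y : representation k G) f g :
  hom_over G X Y f -> hom_over G X Y g -> hom_over G X Y (f - g).
Proof. by move=> homf homg x Gx; rewrite mulmxBr mulmxBl homf ?homg. Qed.

Lemma module_hom_res (H K : {group gT}) X Y f : H \subset K ->
    hom_res K X Y f ->
  hom_res H X Y f.
Proof. by move=> sHK homf x /(subsetP sHK); apply: homf. Qed.

Lemma module_hom_resT H X Y f : hom_over [set: gT] X Y f -> hom_res H X Y f.
Proof. by move=> homf x _; exact: homf (in_setT x). Qed.

Definition rel_trace H X Y (f : 'M[k]_(rdegree X, rdegree Y)) :=
  \sum_(A in rcosets H [set: gT]) X (repr A)^-1%g *m f *m Y (repr A).


Lemma rcosets_repr H A : A \in rcosets H [set: gT] -> H :* repr A = A.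
Proof. by case/rcosetsP=> x _ ->; rewrite rcoset_repr. Qed.

(** The summand X(t)^-1 f Y(t) depends only on the coset H t, because [f]
    commutes with [H]; right multiplication by [g] permutes the cosets. *)
Lemma rel_trace_hom H X Y f :
    hom_res H X Y f ->
  hom_over [set: gT] X Y (rel_trace H f).
Proof.
move=> homf g _; rewrite /rel_trace mulmx_sumr mulmx_suml.
have inT (x : gT) : x \in [set: gT] by rewrite inE.
rewrite [LHS](reindex_inj (can_inj (rcosetK g))) /=.
have rcosetsMg A : (A :* g \in rcosets H [set: gT]) = (A \in rcosets H [set: gT]).
  apply/rcosetsP/rcosetsP=> -[x _ defA].
    by exists (x * g^-1)%g; rewrite // rcosetM -defA rcosetK.
  by exists (x * g)%g; rewrite // rcosetM -defA.
apply: eq_big => // A; rewrite rcosetsMg => HA.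
(* The representative of A g is h t g, with t the one of A and h in H. *)
have: repr (A :* g) \in A :* g.
  by have:= rcosetsMg A; rewrite HA => /rcosetsP[x _ ->]; apply: mem_repr_rcoset.
rewrite -{2}(rcosets_repr HA) -rcosetM => /rcosetP[h Hh ->].
have homfh: X h *m f = f *m Y h by apply: homf.
rewrite !mulmxA -repr_mxM // !invMg !mulgA mulgV mul1g !repr_mxM //.
rewrite -!mulmxA [f *m (Y h *m _)]mulmxA -homfh !mulmxA.
by rewrite -[X _ *m X (h^-1)%g *m X h]mulmxA -repr_mxM // mulVg repr_mx1 mulmx1.
Qed.

Lemma rel_trace_mull H W X Y (g : 'M_(rdegree W, rdegree X)) f :
  hom_over [set: gT] W X g -> g *m @rel_trace H X Y f = @rel_trace H W Y (g *m f).
Proof.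
move=> homg; rewrite mulmx_sumr; apply: eq_bigr => A _.
by rewrite !mulmxA homg ?inE.
Qed.

Lemma rel_trace_mulr H X Y Z f (g : 'M_(rdegree Y, rdegree Z)) :
  hom_over [set: gT] Y Z g -> @rel_trace H X Y f *m g = @rel_trace H X Z (f *m g).
Proof.
move=> homg; rewrite mulmx_suml; apply: eq_bigr => A _.
by rewrite -!mulmxA homg ?inE.
Qed.

(** * Induced modules *)

(** An intrinsic form of X = Ind_H V: [X] is the direct sum of the translates of
    an [H]-submodule [V], included by [ind_in] and projected onto by [ind_out]
    along the other translates.  The field [ind_in_out] says that the translates
    are independent and [ind_trace] that they span [X].  It covers both the block
    matrices of [ind_grepr] and the regular module. *)
Record induced_from H (V : representation k H) X := InducedFrom {
  ind_in : 'M[k]_(rdegree V, rdegree X);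
  ind_out : 'M[k]_(rdegree X, rdegree V);
  ind_in_hom : hom_over H V (res_grepr H X) ind_in;
  ind_out_hom : hom_over H (res_grepr H X) V ind_out;
  ind_inK : ind_in *m ind_out = 1%:M;
  ind_in_out : forall x, x \notin H -> ind_in *m X x *m ind_out = 0;
  ind_trace : @rel_trace H X X (ind_out *m ind_in) = 1%:M
}.

(** Adjunction computations reduce to the trivial coset, whose chosen
    representative is 1. *)
Lemma big_rcosets_id H n m (F : {set gT} -> 'M[k]_(n, m)) :
    (forall A, A \in rcosets H [set: gT] -> repr A \notin H -> F A = 0) ->
  \sum_(A in rcosets H [set: gT]) F A = F H.
Proof.
move=> F0; rewrite (bigD1 (H : {set gT})) /=; last first.
  by apply/rcosetsP; exists 1%g; rewrite ?inE ?mulg1.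
rewrite big1 ?addr0 // => A /andP[HA neqA]; apply: F0 => //.
by apply: contraNN neqA => Hr; rewrite -(rcosets_repr HA) rcoset_id.
Qed.

Section Induced.

Variables (H : {group gT}) (V : representation k H) (X : representation k [set: gT]).
Variable indX : induced_from V X.

(** One triangle of Frobenius reciprocity Hom_G(X, Y) = Hom_H(V, Y). *)
Lemma ind_in_trace Y (g : 'M_(rdegree V, rdegree Y)) :
  ind_in indX *m @rel_trace H X Y (ind_out indX *m g) = g.
Proof.
rewrite mulmx_sumr big_rcosets_id => [|A _ notHA].
  by rewrite repr_group invg1 !repr_mx1 mul1mx mulmx1 mulmxA ind_inK mul1mx.
by rewrite !mulmxA ind_in_out ?groupV // !mul0mx.
Qed.

(** One triangle of the other reciprocity, Hom_G(Y, X) = Hom_H(Y, V): induction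
    along a subgroup of finite index is also coinduction. *)
Lemma trace_ind_out Y (f : 'M_(rdegree Y, rdegree V)) :
  @rel_trace H Y X (f *m ind_in indX) *m ind_out indX = f.
Proof.
rewrite mulmx_suml big_rcosets_id => [|A _ notHA].
  by rewrite repr_group invg1 !repr_mx1 mul1mx mulmx1 -mulmxA ind_inK mulmx1.
by rewrite -!mulmxA [ind_in _ *m _]mulmxA ind_in_out // !mulmx0.
Qed.

End Induced.

Lemma ind_grepr_induced H (V : representation k H) : induced_from V (ind_grepr V).
Proof.
have HT : (H : {set gT}) \in rcosets H [set: gT].
  by apply/rcosetsP; exists 1%g; rewrite ?inE ?mulg1.
pose i0 := enum_rank_in HT H.
pose t := @coset_rep gT H.
have rep0: t i0 = 1%g by rewrite /t /coset_rep enum_rankK_in // repr_group.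
(* All matrices below are made of blocks [blk x], [V] extended by 0 off [H]. *)
pose blk x := if x \in H then V x else 0 : 'M[k]_(rdegree V).
have blkMl h x : h \in H -> blk (h * x)%g = V h *m blk x.
  by move=> Hh; rewrite /blk groupMl //; case: ifP => Hx; rewrite ?mulmx0 ?repr_mxM.
have blkMr h x : h \in H -> blk (x * h)%g = blk x *m V h.
  by move=> Hh; rewrite /blk groupMr //; case: ifP => Hx; rewrite ?mul0mx ?repr_mxM.
have blkE i j : blk (t i * (t j)^-1)%g = if i == j then 1%:M else 0.
  have [->|neq_ij] := eqVneq; first by rewrite mulgV /blk group1 repr_mx1.
  by rewrite /blk ifN //; apply: contra neq_ij => Hij; rewrite (coset_rep_inj Hij).
have blk_rep i : blk (t i) = if i == i0 then 1%:M else 0.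
  by rewrite -blkE rep0 invg1 mulg1.
have blk_repV j : blk (t j)^-1%g = if j == i0 then 1%:M else 0.
  by rewrite eq_sym -blkE rep0 mul1g.
pose inj : 'M_(rdegree V, rdegree (ind_grepr V)) :=
  \mxrow_(j < #|rcosets H [set: gT]|) (if j == i0 then 1%:M else 0 : 'M[k]_(rdegree V)).
pose out : 'M_(rdegree (ind_grepr V), rdegree V) :=
  \mxcol_(i < #|rcosets H [set: gT]|) (if i == i0 then 1%:M else 0 : 'M[k]_(rdegree V)).
have indE x : ind_grepr V x = \mxblock_(i, j) blk (t i * x * (t j)^-1)%g by [].
have injE x : inj *m ind_grepr V x = \mxrow_j blk (x * (t j)^-1)%g.
  rewrite indE mul_mxrow_mxblock; apply: eq_mxrow => j.
  rewrite (bigD1 i0) //= eqxx mul1mx rep0 mul1g big1 ?addr0 // => i /negPf->.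
  by rewrite mul0mx.
have outE x : ind_grepr V x *m out = \mxcol_i blk (t i * x)%g.
  rewrite indE mul_mxblock_mxrow; apply: eq_mxcol => j.
  rewrite (bigD1 i0) //= eqxx mulmx1 rep0 invg1 mulg1 big1 ?addr0 // => i /negPf->.
  by rewrite mulmx0.
exists inj out.
- move=> h Hh; rewrite [RHS]injE mul_mxrow; apply: eq_mxrow => j.
  by rewrite blkMl // blk_repV.
- move=> h Hh; rewrite [LHS]outE mxcol_mul; apply: eq_mxcol => i.
  by rewrite blkMr // blk_rep.
- rewrite mul_mxrow_mxcol (bigD1 i0) //= eqxx mulmx1 big1 ?addr0 // => i /negPf->.
  by rewrite mul0mx.
- move=> x notHx; rewrite injE mul_mxrow_mxcol big1 // => i _.
  case: eqP => [->|_]; rewrite ?mulmx0 // rep0 invg1 mulg1 mulmx1.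
  by rewrite /blk (negPf notHx).
rewrite /rel_trace big_enum_val.
rewrite (eq_bigr (fun i => \mxblock_(a, b)
    (blk (t a * (t i)^-1)%g *m blk (t i * (t b)^-1)%g))) => [|i _]; last first.
  by rewrite -[repr _]/(t i) mulmxA outE -mulmxA injE mul_mxcol_mxrow.
rewrite -mxblock_sum -[RHS]mxdiagZ /mxdiag; apply: eq_mxblock => i j /=.
rewrite (bigD1 i) //= !blkE eqxx mul1mx big1 ?addr0 => [|l /negPf neq_l].
  by case: eqVneq => // neq_ij; rewrite ?conform_mx_id.
by rewrite blkE eq_sym neq_l mul0mx.
Qed.


(** The regular module is spanned by the translates e_x of the line e_1, freely
    permuted by the group. *)
Lemma regular_grepr_induced :
  induced_from (triv_grepr k 1%G) (regular_grepr k [set: gT]%G).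
Proof.
have inT (x : gT) : x \in [set: gT] by rewrite inE.
pose e x := gring_index [set: gT]%G x.
pose X := regular_grepr k [set: gT]%G.
have eK x : enum_val (e x) = x by rewrite gring_indexK.
have e_eq x y : (e x == e y) = (x == y) := can_eq eK x y.
have in_act x : delta_mx 0 (e 1%g) *m X x = delta_mx 0 (e x) :> 'rV[k]_(rdegree X).
  by rewrite -rowE rowK eK mul1g.
have act_out x : X x *m delta_mx (e 1%g) 0 = delta_mx (e x^-1%g) 0 :> 'cV[k]_(rdegree X).
  apply/matrixP=> i j; rewrite -colE ord1 !mxE !andbT -[i](@gring_valK _ [set: gT]%G).
  rewrite eK -/(e _) !e_eq eqxx; congr (nat_of_bool _)%:R.
  by rewrite eq_sym /= mulg_eq1.
exists (delta_mx 0 (e 1%g)) (delta_mx (e 1%g) 0).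
- by move=> x /set1P->; rewrite !repr_mx1 mul1mx mulmx1.
- by move=> x /set1P->; rewrite !repr_mx1 mul1mx mulmx1.
- by rewrite mul_delta_mx; apply/matrixP=> i j; rewrite !ord1 !mxE.
- move=> x; rewrite inE => ntx; rewrite in_act mul_delta_mx_cond e_eq (negPf ntx).
  by rewrite mulr0n.
rewrite /rel_trace big_imset /= => [|x y _ _]; last first.
  by rewrite !rcosetE => /rcoset_eqP; rewrite mem_rcoset inE -eq_mulgV1 => /eqP.
rewrite mx1_sum_delta (reindex e) /=; last first.
  by exists enum_val => i _; [apply: eK | apply: gring_valK].
apply: eq_big => [x|x _]; first by rewrite inE.
have ->: repr (rcoset 1%g x) = x.
  by rewrite rcosetE /rcoset mulg_set1 repr_set1 mul1g.
by rewrite mulmxA act_out invgK -mulmxA in_act mul_delta_mx.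
Qed.

(** * Higman's criterion for relative projectivity *)

Lemma sum_block_diag (I : finType) (P : pred I) n m
    (A : I -> 'M[k]_n) (B : I -> 'M[k]_m) :
  \sum_(i | P i) block_mx (A i) 0 0 (B i)
    = block_mx (\sum_(i | P i) A i) 0 0 (\sum_(i | P i) B i).
Proof.
apply: (big_rec3 (fun x y z => z = block_mx x 0 0 y)) => [|i x y z _ ->].
  by rewrite block_mx0.
by rewrite add_block_mx !addr0.
Qed.

(** Higman's criterion: the identity is a sum of traces from members of [chi].
    Unlike being a summand of a sum of induced modules, it visibly passes to
    direct sums. *)
Definition trace_projective (chi : {set {group gT}}) X :=
  exists2 theta : {group gT} -> 'M[k]_(rdegree X),
    forall H, H \in chi -> hom_res H X X (theta H)
    & \sum_(H in chi) @rel_trace H X X (theta H) = 1%:M.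

Variable chi : {set {group gT}}.

Lemma trace_projective0 : trace_projective chi grepr0.
Proof.
exists (fun=> 0) => [H _|]; first exact: module_hom0.
by apply/matrixP=> -[].
Qed.

Lemma trace_projectiveD X Y :
  trace_projective chi X -> trace_projective chi Y ->
  trace_projective chi (dadd_grepr X Y).
Proof.
move=> [f homf trf] [g homg trg]; exists (fun H => block_mx (f H) 0 0 (g H)).
  move=> H chiH x Hx; rewrite /= !mulmx_block !(mulmx0, mul0mx, addr0, add0r).
  by congr block_mx; [apply: (homf H) | apply: (homg H)].
rewrite [RHS]scalar_mx_block -trf -trg -sum_block_diag; apply: eq_bigr => H _.
rewrite -sum_block_diag; apply: eq_bigr => A _ /=.
by rewrite !mulmx_block !(mulmx0, mul0mx, addr0, add0r).
Qed.

Lemma trace_projective_induced H (V : representation k H) X :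
  H \in chi -> induced_from V X -> trace_projective chi X.
Proof.
move=> chiH D; exists (fun K => if K == H then ind_out D *m ind_in D else 0).
  move=> K _; case: eqP => [->|_]; last exact: module_hom0.
  exact: module_homM (ind_out_hom D) (ind_in_hom D).
rewrite (bigD1 H) //= eqxx ind_trace big1 ?addr0 // => K /andP[_ /negPf->].
by rewrite /rel_trace big1 // => A _; rewrite mulmx0 mul0mx.
Qed.

(** The direct sum is used through its universal properties as a product and as
    a coproduct; putting them in one statement avoids naming its injections and
    projections. *)
Lemma big_dadd_factor (r : seq {group gT}) (P : pred {group gT}) X Y
    (V : {group gT} -> representation k [set: gT])
    (a : forall H, 'M_(rdegree X, rdegree (V H)))
    (b : forall H, 'M_(rdegree (V H), rdegree Y)) :
    (forall H, P H -> hom_over [set: gT] X (V H) (a H)) ->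
    (forall H, P H -> hom_over [set: gT] (V H) Y (b H)) ->
  let S := \big[@dadd_grepr k gT [set: gT]/grepr0]_(H <- r | P H) V H in
  exists f : 'M_(rdegree X, rdegree S), exists g : 'M_(rdegree S, rdegree Y),
  [/\ hom_over [set: gT] X S f, hom_over [set: gT] S Y g
    & f *m g = \sum_(H <- r | P H) a H *m b H].
Proof.
move=> homa homb; elim: r => [|H r [f [g [homf homg fg]]]] /=.
  rewrite !big_nil; exists 0, 0.
  by split; [apply: module_hom0.. | rewrite mulmx0].
rewrite !big_cons; case: ifP => [PH|_]; last by exists f, g.
exists (row_mx (a H) f), (col_mx (b H) g); split.
- move=> x Gx; rewrite mul_mx_row mul_row_block !(mulmx0, addr0, add0r).
  by rewrite homa ?homf.
- move=> x Gx; rewrite [LHS]mul_block_col !(mul0mx, addr0, add0r) mul_col_mx.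
  by rewrite homb ?homg.
by rewrite mul_row_col fg.
Qed.

(** The kernel is returned as data, since the construction of a resolution
    iterates it. *)
Lemma kernel_grepr X Y (f : 'M_(rdegree X, rdegree Y)) : hom_over [set: gT] X Y f ->
  {K : representation k [set: gT] & {c : 'M_(rdegree K, rdegree X) |
    [/\ hom_over [set: gT] K X c, row_free c & (c :=: kermx f)%MS]}}.
Proof.
move=> homf.
have modK : mxmodule X (kermx f).
  apply/mxmoduleP=> x Gx; apply/sub_kermxP.
  by rewrite -mulmxA homf // mulmxA mulmx_ker mul0mx.
exists (Representation (submod_repr modK)), (val_submod 1%:M); split.
- by move=> x Gx; rewrite -val_submodE -(val_submodJ modK) // mul1mx.
- by rewrite /row_free val_submod1.
- exact: val_submod1.
Qed.

Lemma retract_rel_summand X Y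
    (a : 'M_(rdegree X, rdegree Y)) (b : 'M_(rdegree Y, rdegree X)) :
    hom_over [set: gT] X Y a -> hom_over [set: gT] Y X b -> a *m b = 1%:M ->
  exists L, mx_rsim Y (dadd_grepr X L).
Proof.
move=> homa homb ab1; have [L [c [homc free_c kerc]]] := kernel_grepr homb.
have cb0: c *m b = 0 by apply/sub_kermxP; rewrite kerc.
exists L; apply: mx_rsim_sym.
(* 1 - b a projects [Y] onto the kernel of [b]; [r] is this projection with
   values in [L]. *)
pose r := (1%:M - b *m a) *m pinvmx c.
have rc: r *m c = 1%:M - b *m a.
  rewrite mulmxKpV // kerc; apply/sub_kermxP.
  by rewrite mulmxBl mul1mx -mulmxA ab1 mulmx1 subrr.
have deg: rdegree (dadd_grepr X L) = rdegree Y.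
  have <- /=: (rdegree X + rdegree L)%N = rdegree (dadd_grepr X L) by [].
  have <-: \rank (kermx b) = rdegree L by rewrite -kerc; apply/eqP.
  have rkb: \rank b = rdegree X by apply/eqP/row_fullP; exists a.
  by rewrite mxrank_ker rkb subnKC // -rkb rank_leq_row.
exists (col_mx a c) => //.
  apply/row_freeP; exists (row_mx b r); rewrite mul_col_row ab1 cb0.
  have ar: a *m r = 0.
    have aba: a *m (1%:M - b *m a) = 0.
      by rewrite mulmxBr mulmx1 mulmxA ab1 mul1mx subrr.
    by rewrite mulmxA aba mul0mx.
  have cr: c *m r = 1%:M.
    apply: (row_free_inj free_c); rewrite -mulmxA rc mulmxBr mulmxA cb0.
    by rewrite mul0mx subr0 mulmx1 mul1mx.
  by rewrite ar cr -scalar_mx_block.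
move=> x Gx; rewrite [LHS]mul_block_col !(mul0mx, addr0, add0r) mul_col_mx.
by rewrite homa ?homc.
Qed.

(** The map m |-> sum_A (m t_A^-1 theta) (x) t_A to the induced module, followed by
    the counit, is the trace of theta.  Hence the sum of these maps over [chi]
    is a section of the sum of the counits. *)
Lemma trace_projective_rel X : trace_projective chi X -> rel_projective chi X.
Proof.
case=> theta homt tr1; pose V H := ind_grepr (res_grepr H X).
pose D H := ind_grepr_induced (res_grepr H X).
pose a H : 'M_(rdegree X, rdegree (V H)) :=
  @rel_trace H X (V H) (theta H *m ind_in (D H)).
pose b H : 'M_(rdegree (V H), rdegree X) := @rel_trace H (V H) X (ind_out (D H)).
have homa H : H \in chi -> hom_over [set: gT] X (V H) (a H).
  move=> chiH; apply: rel_trace_hom.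
  exact: module_homM (homt H chiH) (ind_in_hom (D H)).
have homb H : H \in chi -> hom_over [set: gT] (V H) X (b H).
  by move=> _; apply: rel_trace_hom; apply: ind_out_hom.
have [f [g [homf homg fg]]] := big_dadd_factor (index_enum _) homa homb.
apply: (retract_rel_summand homf homg); rewrite fg -tr1; apply: eq_bigr => H chiH.
rewrite (@rel_trace_mull H X (V H) X); last exact: homa.
by congr (rel_trace H); exact: (trace_ind_out (D H) (theta H)).
Qed.

(** * Relative projective resolutions *)

(** The counit ind_H (res_H M) -> M is the trace of [ind_out]; the inclusion
    [ind_in] of [M] as the block of the trivial coset is an [H]-section of it. *)
Lemma counit_splits (r : seq {group gT}) (P : pred {group gT}) M :
  let S := \big[@dadd_grepr k gT [set: gT]/grepr0]_(H <- r | P H)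
             ind_grepr (res_grepr H M) in
  {f : 'M_(rdegree S, rdegree M) | hom_over [set: gT] S M f &
    forall H, H \in r -> P H -> exists2 s, hom_res H M S s & s *m f = 1%:M}.
Proof.
elim: r => [|H r [f homf splitf]] /=.
  by exists 0 => //; apply: module_hom0.
rewrite big_cons; case: ifP => PH; last first.
  exists f => // K; rewrite inE => /predU1P[->|]; last exact: splitf.
  by rewrite PH.
have D := ind_grepr_induced (res_grepr H M).
pose e : 'M_(rdegree (ind_grepr (res_grepr H M)), rdegree M) :=
  @rel_trace H (ind_grepr (res_grepr H M)) M (ind_out D).
have home : hom_over [set: gT] (ind_grepr (res_grepr H M)) M e.
  by apply: rel_trace_hom; apply: ind_out_hom.
exists (col_mx e f).
  move=> x Gx; rewrite [LHS]mul_block_col !(mul0mx, addr0, add0r) mul_col_mx.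
  by rewrite home ?homf.
move=> K; rewrite inE => /predU1P[-> _|rK PK].
  exists (row_mx (ind_in D) 0).
    move=> x Hx; rewrite [RHS]mul_row_block !(mulmx0, addr0, add0r) mul_mx_row mulmx0.
    by congr row_mx; [apply: (ind_in_hom D) | rewrite mul0mx].
  rewrite mul_row_col mul0mx addr0 /e -[ind_out D]mulmx1.
  exact: (@ind_in_trace _ _ _ D M 1%:M).
have [s homs sf] := splitf K rK PK; exists (row_mx 0 s).
  move=> x Hx; rewrite [RHS]mul_row_block !(mulmx0, addr0, add0r) mul_mx_row mulmx0.
  by congr row_mx; [rewrite mul0mx | apply: homs].
by rewrite mul_row_col mul0mx add0r.
Qed.

Record rel_cover M := RelCover {
  cov_mod : representation k [set: gT];
  cov_map : 'M[k]_(rdegree cov_mod, rdegree M);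
  cov_ker : representation k [set: gT];
  cov_inc : 'M[k]_(rdegree cov_ker, rdegree cov_mod);
  cov_proj : rel_projective chi cov_mod;
  cov_map_hom : hom_over [set: gT] cov_mod M cov_map;
  cov_map_split : forall H, H \in chi ->
    exists2 s, hom_res H M cov_mod s & s *m cov_map = 1%:M;
  cov_inc_hom : hom_over [set: gT] cov_ker cov_mod cov_inc;
  cov_inc_free : row_free cov_inc;
  cov_inc_ker : (cov_inc :=: kermx cov_map)%MS
}.

Lemma counit_cover M : rel_cover M.
Proof.
have [f homf splitf] := counit_splits (index_enum _) (mem chi) M.
have [K [c [homc free_c kerc]]] := kernel_grepr homf.
apply: (RelCover _ homf _ homc free_c kerc) => [|H chiH]; last first.
  by apply: splitf; rewrite ?mem_index_enum.
apply: trace_projective_rel.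
apply: (big_ind (trace_projective chi)) => [|X Y|H chiH].
- exact: trace_projective0.
- exact: trace_projectiveD.
exact: trace_projective_induced chiH (ind_grepr_induced _).
Qed.

(** With [s] an [H]-section of the cover [f], the endomorphism 1 - f s is an
    [H]-projection onto the kernel. *)
Lemma cov_inc_retract M (C : rel_cover M) H : H \in chi ->
  exists2 r, hom_res H (cov_mod C) (cov_ker C) r & cov_inc C *m r = 1%:M.
Proof.
move=> chiH; have [s homs sf] := cov_map_split C chiH.
have homf := @module_hom_resT H _ _ _ (@cov_map_hom _ C).
have homc := @module_hom_resT H _ _ _ (@cov_inc_hom _ C).
set f := cov_map C in sf homf *; set c := cov_inc C in homc *.
have free_c : row_free c := cov_inc_free C.
have kerc : (c :=: kermx f)%MS := cov_inc_ker C.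
pose p := 1%:M - f *m s.
have homp : hom_res H (cov_mod C) (cov_mod C) p.
  by apply: module_homB; [apply: module_hom1 | apply: module_homM homf homs].
have rc : p *m pinvmx c *m c = p.
  rewrite mulmxKpV // kerc; apply/sub_kermxP.
  by rewrite mulmxBl mul1mx -mulmxA sf mulmx1 subrr.
have cf0 : c *m f = 0 by apply/sub_kermxP; rewrite kerc.
exists (p *m pinvmx c).
  move=> x Hx; apply: (row_free_inj free_c).
  rewrite -[LHS]mulmxA rc -[RHS]mulmxA homc // [RHS]mulmxA rc; exact: homp.
apply: (row_free_inj free_c); rewrite -mulmxA rc mulmxBr mulmxA cf0.
by rewrite mul0mx subr0 mulmx1 mul1mx.
Qed.

Fixpoint syzygy M n : representation k [set: gT] :=
  if n is n'.+1 then cov_ker (counit_cover (syzygy M n')) else M.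

Lemma cov_map_full M (C : rel_cover M) : chi != set0 -> row_full (cov_map C).
Proof.
case/set0Pn=> H chiH; have [s _ sf] := cov_map_split C chiH.
by apply/row_fullP; exists s.
Qed.

(** The differentials are the covers of the syzygies followed by their
    inclusions; each splits over [H] because both of its factors do. *)
Lemma rel_resolution_exists M : chi != set0 -> inhabited (rel_resolution chi M).
Proof.
move=> chi0; pose C n := counit_cover (syzygy M n).
pose d n : 'M_(rdegree (cov_mod (C n.+1)), rdegree (cov_mod (C n))) :=
  cov_map (C n.+1) *m cov_inc (C n).
have incK n : cov_inc (C n) *m pinvmx (cov_inc (C n)) = 1%:M.
  exact: mulmxVp (cov_inc_free (C n)).
have imd n : (d n :=: kermx (cov_map (C n)))%MS.
  apply: eqmx_trans (cov_inc_ker (C n)); apply: eqmxMfull; exact: cov_map_full.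
constructor.
apply: (@RelResolution k gT chi M (fun n => cov_mod (C n)) d (cov_map (C 0))).
- by move=> n; apply: cov_proj.
- by move=> n; apply: module_homM (@cov_map_hom _ (C n.+1)) (@cov_inc_hom _ (C n)).
- exact: (@cov_map_hom _ (C 0)).
- move=> n; apply: eqmx_trans (imd n.+1) _; apply/eqmxP.
  apply/andP; split; apply/sub_kermxP; first by rewrite mulmxA mulmx_ker mul0mx.
  apply: (row_free_inj (cov_inc_free (C n))).
  by rewrite mul0mx -mulmxA mulmx_ker.
- exact: imd.
- exact: cov_map_full.
- move=> H n chiH.
  have [s homs sf] := cov_map_split (C n.+1) chiH.
  have [r homr cr] := cov_inc_retract (C n) chiH.
  exists (r *m s); first exact: module_homM homr homs.
  by rewrite /d !mulmxA -[_ *m _ *m r]mulmxA cr mulmx1 -[_ *m s *m _]mulmxA sf mulmx1.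
move=> H chiH; have [s homs sf] := cov_map_split (C 0) chiH.
by exists s => //; rewrite -mulmxA sf mulmx1.
Qed.

(** * Acyclicity of induced modules *)

Section Acyclicity.

Variables (H K : {group gT}) (V : representation k H) (N : representation k [set: gT]).
Hypotheses (indN : induced_from V N) (sHK : H \subset K).

(** Relative injectivity of [N]: the extension s f of [f] given by a splitting
    [s] of [d] is only an [H]-map, and the trace makes it a [G]-map without
    spoiling its restriction along [d]. *)
Lemma extend_along_split A B
    (d : 'M_(rdegree A, rdegree B)) (f : 'M_(rdegree A, rdegree N)) :
    hom_over [set: gT] A B d -> Defs.splits_over K d -> hom_over [set: gT] A N f ->
    (kermx d : 'M[k]_(rdegree A)) *m f = 0 ->
  exists2 g, hom_over [set: gT] B N g & d *m g = f.
Proof.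
move=> homd [s /(module_hom_res sHK) homs dsd] homf kdf.
(* The image of 1 - d s lies in the kernel of [d], on which [f] vanishes. *)
have dsf : d *m (s *m f) = f.
  apply/eqP; rewrite eq_sym -subr_eq0 mulmxA -{1}[f]mul1mx -mulmxBl; apply/eqP.
  have: (1%:M - d *m s <= kermx d)%MS.
    by apply/sub_kermxP; rewrite mulmxBl mul1mx dsd subrr.
  by case/submxP=> D ->; rewrite -mulmxA kdf mulmx0.
pose p := ind_out indN *m ind_in indN.
have homp : hom_res H N N p := module_homM (ind_out_hom indN) (ind_in_hom indN).
exists (@rel_trace H B N (s *m f *m p)).
  apply: rel_trace_hom; apply: module_homM homp.
  exact: module_homM homs (module_hom_resT homf).
rewrite (rel_trace_mull _ _ homd) [d *m _]mulmxA dsf -(rel_trace_mull _ _ homf).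
by rewrite ind_trace mulmx1.
Qed.

End Acyclicity.

(** By reciprocity Hom_G(k, N) = Hom_H(k, k); the generator [v] is the sum of the
    basis vectors permuted by [G]. *)
Lemma triv_hom_line (H : {group gT}) N (indN : induced_from (triv_grepr k H) N) :
  let v : 'M_(1, rdegree N) := @rel_trace H (triv_grepr k [set: gT]%G) N (ind_in indN) in
  [/\ v != 0, hom_over [set: gT] (triv_grepr k [set: gT]%G) N v &
  forall g, hom_over [set: gT] (triv_grepr k [set: gT]%G) N g -> exists c, g = c *: v].
Proof.
move=> v; pose T := triv_grepr k [set: gT]%G.
have vout : v *m ind_out indN = 1%:M.
  by have:= trace_ind_out indN (1%:M : 'M_(rdegree T, _)); rewrite mul1mx.
split.
- by apply: contra_eq_neq vout => ->; rewrite mul0mx eq_sym oner_neq0.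
- apply: rel_trace_hom; exact: (ind_in_hom indN).
move=> g homg; pose c := (g *m ind_out indN) 0 0; exists c.
rewrite -[LHS]mulmx1 -(ind_trace indN) (rel_trace_mull _ _ homg) mulmxA.
rewrite [g *m _]mx11_scalar -/c mul_scalar_mx /v /rel_trace scaler_sumr.
by apply: eq_bigr => A _; rewrite -scalemxAr -scalemxAl.
Qed.

(** The member [K] of [chi] provides the splittings, while [H] may be smaller: for
    the regular module it is trivial. *)
Lemma rel_cohomology_induced (H K : {group gT}) N (i : nat) :
    induced_from (triv_grepr k H) N -> H \subset K -> K \in chi ->
  rel_cohomology_dim chi N i (if i == 0%N then 1%N else 0%N).
Proof.
move=> indN sHK chiK; split.
  by apply: rel_resolution_exists; apply/set0Pn; exists K.
move=> Q; rewrite /rel_Ext_dim; case: i => [|i] /=; last first.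
  apply/eqP; rewrite subn_eq0; apply: dimvS; apply/subvP=> f.
  rewrite memv_cap memv_ker lfunE /= => /andP[/hom_vspaceP homf /eqP df0].
  have kdf : kermx (rr_diff Q i) *m f = 0.
    have /submxP[D ->]: (kermx (rr_diff Q i) <= rr_diff Q i.+1)%MS.
      by rewrite (rr_exact Q i).
    by rewrite -mulmxA df0 mulmx0.
  have [g homg <-] := extend_along_split indN sHK (@rr_diff_hom _ _ _ _ Q i)
    (rr_diff_split Q i chiK) homf kdf.
  apply/memv_imgP; exists g; first exact/hom_vspaceP.
  by rewrite lfunE.
(* In degree 0 the cocycles are the maps that factor through the augmentation. *)
have [v0 homv linev] := triv_hom_line indN; set v := rel_trace _ _ in v0 homv linev.
have fulla := rr_aug_surj Q.
rewrite dimv0 subn0; suffices ->: cocycles N Q 0 = <[rr_aug Q *m v]>%VS.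
  rewrite dim_vline; case: eqP => // av0; case/eqP: v0.
  by apply: (row_full_inj fulla); rewrite av0 mulmx0.
apply/vspaceP=> f; rewrite memv_cap memv_ker lfunE /=.
apply/andP/vlineP=> [[/hom_vspaceP homf /eqP df0]|[c ->]].
  have kaf : kermx (rr_aug Q) *m f = 0.
    have /submxP[D ->]: (kermx (rr_aug Q) <= rr_diff Q 0)%MS by rewrite (rr_exact0 Q).
    by rewrite -mulmxA df0 mulmx0.
  have [g homg <-] := extend_along_split indN sHK (@rr_aug_hom _ _ _ _ Q)
    (rr_aug_split Q chiK) homf kaf.
  by have [c ->] := linev g homg; exists c; rewrite scalemxAr.
have da0 : rr_diff Q 0 *m rr_aug Q = 0 by apply/sub_kermxP; rewrite (rr_exact0 Q).
split; last by rewrite -scalemxAr mulmxA da0 mul0mx scaler0.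
apply: memvZ; apply/hom_vspaceP; exact: module_homM (@rr_aug_hom _ _ _ _ Q) homv.
Qed.

End RelativeCohomology.

Theorem proposition18 (gT : finGroupType) (sigma tau : gT)
    (klein_abelem : (2.-abelem [set: gT])%g) (klein_card : #|gT| = 4%N)
    (klein_gen : <<[set sigma; tau]>>%g = [set: gT])
    (k : fieldType) (char_k : 2%N \in [pchar k]%R)
    (chi : {set {group gT}})
    (def_chi : chi = [set <[sigma]>%G; <[tau]>%G; <[(sigma * tau)%g]>%G])
    (N : representation k [set: gT]%G)
    (def_N : N = regular_grepr k [set: gT]%G \/
             N = ind_grepr (triv_grepr k <[sigma]>%G) \/
             N = ind_grepr (triv_grepr k <[tau]>%G) \/
             N = ind_grepr (triv_grepr k <[(sigma * tau)%g]>%G))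
    (i : nat) :
  rel_cohomology_dim chi N i (if i == 0%N then 1%N else 0%N).
Proof.
rewrite {}def_chi; case: def_N => [|[|[|]]] -> {N}.
- apply: (rel_cohomology_induced _ (regular_grepr_induced k gT) (sub1G <[sigma]>)).
  by rewrite !inE eqxx.
- by apply: (rel_cohomology_induced _ (ind_grepr_induced _) (subxx _)); rewrite !inE eqxx.
- apply: (rel_cohomology_induced _ (ind_grepr_induced _) (subxx _)).
  by rewrite !inE eqxx orbT.
apply: (rel_cohomology_induced _ (ind_grepr_induced _) (subxx _)).
by rewrite !inE eqxx orbT.
Qed.
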